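(* Let $V\in\mathbb{R}$ and $M_V(w)=\frac{1}{\sqrt{2\pi}}\exp\left(-\frac12(w-V)^2\right)$. There exists a finite constant $\hat{C}$ such that for every $\varphi\in W_0$, the function $u=\varphi/M_V$, which belongs to $AC_{\mathrm{loc}}(\mathbb{R})$, satisfies $$\int_{-\infty}^{\infty}(u(w))^2\,M_V(w)\,\mathrm{d}w\le\hat{C}\int_{-\infty}^{\infty}(u'(w))^2\,M_V(w)\,\mathrm{d}w.$$
   Context: $W_0=\left\{\varphi\in H^1(\mathbb{R})\cap L^1(\mathbb{R}) : \int_{\mathbb{R}}\varphi(w)\,\mathrm{d}w=0\right\}$, with real-valued functions. Every element of $H^1(\mathbb{R})$ is identified with its locally absolutely continuous representative. $AC_{\mathrm{loc}}(\mathbb{R})$ is the set of functions $F:\mathbb{R}\to\mathbb{R}$ that are absolutely continuous on every compact interval $[\lambda,\gamma]\subset\mathbb{R}$; $u'$ denotes the almost everywhere derivative. The integrals are allowed to take the value $+\infty$. *)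

(* Defs.v *)
From HB Require Import structures.
From mathcomp Require Import all_boot all_order all_algebra.
From mathcomp Require Import all_classical all_reals all_analysis.

Set Implicit Arguments.
Unset Strict Implicit.
Unset Printing Implicit Defensive.
Import Order.TTheory GRing.Theory Num.Theory.
Import numFieldNormedType.Exports.

Local Open Scope classical_set_scope.
Local Open Scope ring_scope.

Definition maxwellian (R : realType) (V w : R) : R :=
  (Num.sqrt (2 * pi))^-1 * expR (- (1 / 2) * (w - V) ^+ 2).

(* Degenerate intervals (a i = b i) are harmless: they contribute 0 to both
   sums. *)
Definition abs_continuous_on (R : realType) (l r : R) (f : R -> R) : Prop :=
  forall e : R, 0 < e -> exists2 d : R, 0 < d &
    forall (n : nat) (a b : 'I_n -> R),
      (forall i, [/\ l <= a i, a i <= b i & b i <= r]) ->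
      trivIset [set: 'I_n] (fun i => `]a i, b i[%classic) ->
      \sum_(i < n) (b i - a i) < d ->
      \sum_(i < n) `|f (b i) - f (a i)| < e.

Definition AC_loc (R : realType) (f : R -> R) : Prop :=
  forall l r : R, l <= r -> abs_continuous_on l r f.

Definition test_function (R : realType) (psi : R -> R) : Prop :=
  (forall (n : nat) (x : R), derivable (derive1n n psi) x 1) /\
  compact (closure [set x | psi x != 0]).

Definition weak_derivative (R : realType) (f g : R -> R) : Prop :=
  forall psi : R -> R, test_function psi ->
    \int[lebesgue_measure]_x (f x * derive1 psi x) =
    - \int[lebesgue_measure]_x (g x * psi x).

(* The elements of H^1 are functions rather than classes modulo a.e. equality:
   each class is represented by its locally absolutely continuous member. *)
Definition H1 (R : realType) (phi : R -> R) : Prop :=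
  [/\ AC_loc phi, phi \in Lfun lebesgue_measure 2%:E &
      exists2 g : R -> R, g \in Lfun lebesgue_measure 2%:E &
        weak_derivative phi g].

Definition W0 (R : realType) (phi : R -> R) : Prop :=
  [/\ H1 phi, phi \in Lfun lebesgue_measure 1%E &
      \int[lebesgue_measure]_w phi w = 0].

(* Main.v *)
Require Import Defs.
From HB Require Import structures.
From mathcomp Require Import all_boot all_order all_algebra.
From mathcomp Require Import all_classical all_reals all_analysis.
From mathcomp Require Import measurable_realfun ring lra.

Set Implicit Arguments.
Unset Strict Implicit.
Unset Printing Implicit Defensive.
Import Order.TTheory GRing.Theory Num.Theory.
Import numFieldNormedType.Exports.

Local Open Scope classical_set_scope.
Local Open Scope ring_scope.

(** Write M for the Maxwellian and u = phi / M.  The inequality is the Poincare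
    inequality of the Gaussian measure of mean V and variance 1, and it holds
    with constant 1.

    Let h be the weak derivative of u.  The core is the one-dimensional
    estimate [gaussian_hardy].  By Cauchy-Schwarz,
    (u x - u V)^2 <= |x - V| * |integral of h^2 between V and x|.  Multiply by
    M x, integrate in x and exchange the integrals: for t > V, the weight that
    multiplies h(t)^2 is the integral of (x - V) M(x) over [t, +oo[, which is
    exactly M(t) because M' = - (x - V) M; the case t < V is symmetric.  Hence
    the integral of (u - u V)^2 M is at most the integral of h^2 M.  Since the
    integral of u M = phi vanishes and M has mass 1, subtracting the constant
    u V can only increase the integral of u^2 M ([gaussian_poincare]).

    What remains is to know that u is the primitive of h and that the pointwise
    derivative of u is h almost everywhere.  The weak derivative of a product
    with a smooth function obeys the Leibniz rule ([weak_derivativeM]), so that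
    h = g / M + phi (1 / M)' for g the weak derivative of phi.  Testing against
    smooth approximations of the indicator function of ]a, b] then gives
    u b - u a = integral of h over ]a, b] ([weak_derivative_FTC]), and the
    Lebesgue differentiation theorem gives u' = h almost everywhere
    ([ae_derive1_primitive]).  The test functions come from the classical flat
    function exp(-1/x). *)

(** * Infinitely derivable functions and a smooth step *)

Definition infinitely_derivable (R : realType) (f : R -> R) : Prop :=
  forall (n : nat) (x : R), derivable (derive1n n f) x 1.

(** exp(-1/x) on the positive half-line, extended by 0.  The extra factor x^-n
    makes the span of the family closed under derivation. *)
Definition flat (R : realType) (n : nat) (x : R) : R :=
  if 0 < x then x^-1 ^+ n * expR (- x^-1) else 0.

Lemma flat_ge0 (R : realType) n (x : R) : 0 <= flat n x.
Proof.
rewrite /flat; case: ifPn => // x0.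
by rewrite mulr_ge0 ?expR_ge0// exprn_ge0// invr_ge0 ltW.
Qed.

(** One term of the exponential series at 1/x beats x^-n and leaves a factor x
    to spare: this is the flatness at the origin. *)
Lemma flat_le (R : realType) n (x : R) : flat n x <= (n.+1)`!%:R * `|x|.
Proof.
rewrite /flat; case: ifPn => x0; last by rewrite mulr_ge0.
rewrite gtr0_norm// expRN ler_pdivrMr ?expR_gt0//.
have y0 : 0 < x^-1 by rewrite invr_gt0.
have f0 : 0 < (n.+1)`!%:R :> R by rewrite ltr0n fact_gt0.
rewrite -(ler_pdivrMl _ _ (mulr_gt0 f0 x0)).
apply: le_trans (expR_ge1Dxn n (ltW y0)).
rewrite invfM mulrAC exprSr -[X in X <= _]mulrA [_^-1 * (_ * _)]mulrC.
by rewrite lerDr.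
Qed.

Lemma is_derive_flat (R : realType) n (x : R) :
  is_derive x 1 (flat n) (flat n.+2 x - n%:R * flat n.+1 x).
Proof.
have [x0|x0|->] := ltgtP x 0.
- rewrite /flat !ltNge (ltW x0)/= mulr0 subr0.
  apply: (@near_eq_is_derive _ _ _ (cst 0)).
    near=> y; rewrite ltNge ifN// negbK ltW//.
    by near: y; exact: lt_nbhsl.
- rewrite /flat x0.
  apply: (@near_eq_is_derive R R^o R^o (fun y => y^-1 ^+ n * expR (- y^-1))).
    near=> y; rewrite ifT//.
    by near: y; exact: lt_nbhsr.
  have xN0 : x != 0 by rewrite gt_eqF.
  have dV : is_derive x 1 (fun y : R => y^-1) (- x ^- 2).
    have := @is_deriveV R id x 1 1 xN0 (is_derive_id _ _).
    by rewrite -[_ *: 1]/(_ * 1) mulr1.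
  have dX : is_derive x 1 (fun y : R => y^-1 ^+ n)
      ((n%:R * x^-1 ^+ n.-1) * - x ^- 2).
    have := @is_deriveX _ _ (fun y : R => y^-1) n x 1 _ dV.
    by congr is_derive; apply/funext => y; rewrite exprfctE.
  have dE : is_derive x 1 (fun y : R => expR (- y^-1))
      (expR (- x^-1) * (- - x ^- 2)).
    apply: (@is_derive1_comp _ expR (fun y : R => - y^-1)).
  have := @is_deriveM _ _ _ _ _ _ _ _ dX dE.
  move/is_derive_eq; apply.
  rewrite -![_ *: _]/(_ * _)%R.
  case: n dX => [|n] _ /=.
    by rewrite !mul0r mulr0 subr0 addr0 expr0 mul1r opprK exprVn mulrC.
  by rewrite -!exprVn !exprS; ring.
(* At 0 the slope of flat n is flat n.+1, which tends to 0. *)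
- rewrite [X in is_derive _ _ _ X](_ : _ = 0); last first.
    by rewrite /flat ltxx mulr0 subr0.
  apply/is_derive1_caratheodory; exists (flat n.+1); split.
  + move=> z; rewrite /flat ltxx !subr0; case: ifPn => z0; last by rewrite mul0r.
    by rewrite exprSr mulrAC -[_ * z^-1 * z]mulrA mulVf ?mulr1 ?gt_eqF.
  + have f0 : flat n.+1 0 = 0 :> R by rewrite /flat ltxx.
    rewrite /prop_for /continuous_at f0; apply/cvgrPdist_le => e e0; near=> y.
    rewrite sub0r normrN ger0_norm ?flat_ge0// (le_trans (flat_le _ _))//.
    rewrite -ler_pdivlMl ?ltr0n ?fact_gt0//.
    near: y; apply: (@nbhs0_le R R^o).
    by rewrite mulr_gt0// invr_gt0 ltr0n fact_gt0.
  + by rewrite /flat ltxx.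
Unshelve. all: by end_near. Qed.

(** A device that replaces the closed formulas for the iterated derivatives of
    products, inverses and composites: the derivative of a member is again a
    member, so that computing one derivative settles all orders. *)
Inductive smooth_closure (R : realType) : (R -> R) -> Prop :=
| smooth_closure_base f of infinitely_derivable f : smooth_closure f
| smooth_closure_flat n : smooth_closure (@flat R n)
| smooth_closureD f g of smooth_closure f & smooth_closure g :
    smooth_closure (fun x => f x + g x)
| smooth_closureM f g of smooth_closure f & smooth_closure g :
    smooth_closure (fun x => f x * g x)
| smooth_closureV f of smooth_closure f & (forall x, f x != 0) :
    smooth_closure (fun x => (f x)^-1)
| smooth_closure_comp f g of smooth_closure f & smooth_closure g :
    smooth_closure (fun x => f (g x)).

Lemma is_derive1E (R : realType) (f f' : R -> R) :
  (forall x : R, is_derive x 1 f (f' x)) -> derive1 f = f'.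
Proof. by move=> ff'; apply/funext => x; rewrite derive1E derive_val. Qed.

Lemma infinitely_derivable_cst (R : realType) (c : R) :
  infinitely_derivable (cst c).
Proof.
move=> n; suff [d ->] : exists d, derive1n n (cst c) = cst d.
  by move=> x; exact: derivable_cst.
elim: n => [|n [d IH]]; first by exists c.
by exists 0; rewrite derive1nS IH; apply: is_derive1E.
Qed.

Lemma infinitely_derivableS (R : realType) (f f' : R -> R) :
  (forall x : R, is_derive x 1 f (f' x)) ->
  infinitely_derivable f' -> infinitely_derivable f.
Proof.
move=> ff' sf' [|n] x; first exact: (@ex_derive _ _ _ _ _ _ _ (ff' x)).
by rewrite derive1Sn (is_derive1E ff').
Qed.

Lemma infinitely_derivable_derive1 (R : realType) (f : R -> R) :
  infinitely_derivable f -> infinitely_derivable (derive1 f).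
Proof. by move=> sf n x; rewrite -derive1Sn. Qed.

Lemma smooth_closure_is_derive (R : realType) (f : R -> R) :
  smooth_closure f ->
  exists2 f', smooth_closure f' & forall x : R, is_derive x 1 f (f' x).
Proof.
have cstP c : smooth_closure (cst c : R -> R).
  exact/smooth_closure_base/infinitely_derivable_cst.
elim=> {f}.
- move=> f sf; exists (derive1 f).
    exact/smooth_closure_base/infinitely_derivable_derive1.
  by move=> x; rewrite derive1E; apply/derivableP/(sf 0).
- move=> n; exists (fun x => flat n.+2 x + cst (- n%:R) x * flat n.+1 x).
    apply: smooth_closureD; first exact: smooth_closure_flat.
    by apply: smooth_closureM => //; exact: smooth_closure_flat.
  by move=> x; rewrite mulNr; exact: is_derive_flat.
- move=> f g _ [f' sf' ff'] _ [g' sg' gg'].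
  exists (fun x => f' x + g' x); first exact: smooth_closureD.
  by move=> x; exact: is_deriveD.
- move=> f g sf [f' sf' ff'] sg [g' sg' gg'].
  exists (fun x => f x * g' x + g x * f' x).
    by apply: smooth_closureD; exact: smooth_closureM.
  by move=> x; exact: is_deriveM.
- move=> f sf [f' sf' ff'] f0.
  exists (fun x => cst (- 1) x * ((f x)^-1 * (f x)^-1) * f' x).
    apply: smooth_closureM => //; apply: smooth_closureM => //.
    by apply: smooth_closureM => //; exact: smooth_closureV.
  move=> x; have := is_deriveV (f0 x) (ff' x).
  by move/is_derive_eq; apply; rewrite -[_ *: _]/(_ * _) mulN1r -invfM -expr2.
- move=> f g sf [f' sf' ff'] sg [g' sg' gg'].
  exists (fun x => f' (g x) * g' x).
    by apply: smooth_closureM => //; exact: smooth_closure_comp.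
  by move=> x; apply: is_derive1_comp.
Qed.

Lemma smooth_closureP (R : realType) (f : R -> R) :
  smooth_closure f -> infinitely_derivable f.
Proof.
move=> sf n; elim: n f sf => [|n IH] f sf x.
  by have [f' _ ff'] := smooth_closure_is_derive sf; exact: ex_derive.
have [f' sf' ff'] := smooth_closure_is_derive sf.
by rewrite derive1Sn (is_derive1E ff'); exact: IH.
Qed.

Lemma infinitely_derivable_id (R : realType) : infinitely_derivable (@id R).
Proof.
apply: (@infinitely_derivableS R id (cst 1)).
exact: infinitely_derivable_cst.
Qed.

Lemma infinitely_derivable_expR (R : realType) : infinitely_derivable (@expR R).
Proof.
move=> n; suff -> : derive1n n (@expR R) = expR by exact: derivable_expR.
by elim: n => // n IH; rewrite derive1nS IH; apply: is_derive1E.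
Qed.

Lemma infinitely_derivableM (R : realType) (f g : R -> R) :
  infinitely_derivable f -> infinitely_derivable g ->
  infinitely_derivable (fun x => f x * g x).
Proof.
move=> sf sg; apply: smooth_closureP.
by apply: smooth_closureM; exact: smooth_closure_base.
Qed.

Lemma infinitely_derivable_is_derive (R : realType) (f : R -> R) :
  infinitely_derivable f -> forall x : R, is_derive x 1 f (derive1 f x).
Proof. by move=> sf x; rewrite derive1E; apply/derivableP/(sf 0). Qed.

Lemma infinitely_derivable_continuous (R : realType) (f : R -> R) :
  infinitely_derivable f -> continuous f.
Proof.
by move=> sf x; apply/differentiable_continuous/derivable1_diffP/(sf 0).
Qed.

(** The affine map is spelled 1 + -1 * x to match the constructors of
    [smooth_closure]. *)
Definition smooth_step (R : realType) (x : R) : R :=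
  flat 0 x * (flat 0 x + flat 0 (1 + -1 * x))^-1.

(** One of x and 1 - x is positive. *)
Lemma smooth_step_denominator_gt0 (R : realType) (x : R) :
  0 < flat 0 x + flat 0 (1 + -1 * x).
Proof.
have [x0|x0] := ltP 0 x.
  by rewrite ltr_pwDl ?flat_ge0// /flat x0 expr0 mul1r expR_gt0.
rewrite ltr_wpDl ?flat_ge0// /flat ifT ?expr0 ?mul1r ?expR_gt0//.
lra.
Qed.

Lemma infinitely_derivable_smooth_step (R : realType) :
  infinitely_derivable (@smooth_step R).
Proof.
have cstP c : smooth_closure (cst c : R -> R).
  exact/smooth_closure_base/infinitely_derivable_cst.
have idP := smooth_closure_base (@infinitely_derivable_id R).
have fP n := @smooth_closure_flat R n.
apply: smooth_closureP; apply: smooth_closureM => //.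
apply: smooth_closureV; last first.
  by move=> x; rewrite gt_eqF// smooth_step_denominator_gt0.
apply: smooth_closureD => //.
apply: (@smooth_closure_comp _ (flat 0) (fun x => 1 + -1 * x)) => //.
apply: (@smooth_closureD _ (cst 1) (fun x => -1 * x)) => //.
exact: (@smooth_closureM _ (cst (-1)) id).
Qed.

Lemma smooth_step0 (R : realType) (x : R) : x <= 0 -> smooth_step x = 0.
Proof. by rewrite /smooth_step {1}/flat ltNge => ->; rewrite mul0r. Qed.

Lemma smooth_step1 (R : realType) (x : R) : 1 <= x -> smooth_step x = 1.
Proof.
move=> x1; rewrite /smooth_step [flat 0 (_ + _)](_ : _ = 0) ?addr0.
  rewrite divff// /flat ifT ?expr0 ?mul1r ?gt_eqF ?expR_gt0//.
  exact: lt_le_trans x1.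
by rewrite /flat ifF//; lra.
Qed.

Lemma smooth_step_itv (R : realType) (x : R) : 0 <= smooth_step x <= 1.
Proof.
have := smooth_step_denominator_gt0 x; rewrite /smooth_step => d0.
apply/andP; split; first by rewrite divr_ge0 ?flat_ge0// ltW.
by rewrite ler_pdivrMr// mul1r lerDl flat_ge0.
Qed.

(** * Locally integrable functions and weak derivatives *)

Section locally_integrable_extra.
Context {R : realType}.
Implicit Types (f g k : R -> R).
Local Notation mu := (@lebesgue_measure R).

Lemma locally_integrable_itv f (i : interval R) (a b : R) :
  locally_integrable setT f -> [set` i] `<=` `[a, b]%classic ->
  mu.-integrable [set` i] (EFin \o f).
Proof.
move=> [mf _ intf] iab; apply/integrableP; split.
  by apply/measurable_EFinP; exact: measurable_funS mf.
apply: le_lt_trans (intf `[a, b]%classic _ (@segment_compact _ a b)) => //.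
apply: ge0_subset_integral => //.
by do 2 apply: measurableT_comp => //; exact: measurable_funS mf.
Qed.

Lemma itv_locally_integrable f :
  (forall a b : R, mu.-integrable `[a, b] (EFin \o f)) ->
  locally_integrable setT f.
Proof.
move=> intf.
have cov (K : set R) : compact K -> exists a b : R, K `<=` `[a, b]%classic.
  move=> /compact_bounded[M [_ /(_ (M + 1) (ltr_pwDr ltr01 (lexx _))) KM]].
  exists (- (M + 1)), (M + 1) => x /KM /=.
  by rewrite in_itv/= -ler_norml.
split; [|exact: openT|]; last first.
  move=> K _ cK; have [a [b Kab]] := cov K cK.
  have /integrableP[mf foo] := intf a b.
  apply: le_lt_trans foo; apply: ge0_subset_integral => //.
    exact: compact_measurable.
  by apply/measurable_EFinP/measurableT_comp => //; exact/measurable_EFinP.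
have -> : [set: R] = \bigcup_(n in @setT nat) `[- n%:R, n%:R]%classic.
  apply/seteqP; split => // x _; exists (Num.truncn `|x|).+1 => //=.
  by rewrite in_itv/= -ler_norml ltW// truncnS_gt.
apply/measurable_fun_bigcup => // n.
by apply/measurable_EFinP; exact: measurable_int (intf _ _).
Qed.

Lemma continuous_locally_integrable f :
  continuous f -> locally_integrable setT f.
Proof.
move=> cf; apply: itv_locally_integrable => a b.
apply: continuous_compact_integrable; first exact: segment_compact.
exact: continuous_subspaceT.
Qed.

Lemma locally_integrableMc f k :
  locally_integrable setT f -> continuous k ->
  locally_integrable setT (fun x => f x * k x).
Proof.
move=> lf ck; apply: itv_locally_integrable => a b.
have fab : mu.-integrable `[a, b] (EFin \o f).
  exact: (locally_integrable_itv lf (@subset_refl _ _)).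
have := @integrableMl _ _ _ mu _ (measurable_itv `[a, b]) _ k fab.
apply.
  exact: measurable_funS (continuous_measurable_fun ck).
have : compact (k @` `[a, b]).
  apply: continuous_compact; first exact: continuous_subspaceT.
  exact: segment_compact.
move=> /compact_bounded[M [Mr kM]]; exists M; split => // r Mr' x abx.
by apply: (kM _ Mr'); exists x.
Qed.

Lemma integrable_locally_compact_support f k (N : R) :
  locally_integrable setT f -> continuous k ->
  (forall x, N < `|x| -> k x = 0) ->
  mu.-integrable setT (EFin \o (fun x => f x * k x)).
Proof.
move=> lf ck k0; have lfk := locally_integrableMc lf ck.
have := locally_integrable_itv lfk (@subset_refl _ `[- N, N]%classic).
rewrite integrable_mkcond//; apply: eq_integrable => // x _.
rewrite restrict_EFin /= patchE; case: ifPn => //.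
rewrite notin_setE/= in_itv/= => /negP; rewrite -ler_norml -ltNge => /k0 ->.
by rewrite mulr0.
Qed.

(** On a bounded interval |g| <= 1 + g^2. *)
Lemma Lfun2_locally_integrable (g : R -> R) :
  g \in Lfun mu 2%:E -> locally_integrable setT g.
Proof.
move=> g2; have mg : measurable_fun setT g.
  by move: g2; rewrite inE => /andP[/[!inE]/=].
have /open_integrable_locally := Lfun2_integrable_sqr g2.
move=> /(_ openT) lg2.
apply: itv_locally_integrable => a b.
have ig2 := locally_integrable_itv lg2 (@subset_refl _ `[a, b]%classic).
have i1 : mu.-integrable `[a, b] (EFin \o cst (1 : R)).
  apply: continuous_compact_integrable; first exact: segment_compact.
  by apply: continuous_subspaceT => x; exact: cst_continuous.
apply: le_integrable (integrableD _ i1 ig2) => //.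
  by apply/measurable_EFinP; exact: measurable_funS mg.
move=> x _ /=; rewrite lee_fin [leRHS]ger0_norm ?addr_ge0 ?sqr_ge0//.
rewrite -(real_normK (num_real (g x))); move: (`|g x|) => y.
have := sqr_ge0 (y - 1); have := sqr_ge0 y; nra.
Qed.

End locally_integrable_extra.

Section weak_derivative_extra.
Context {R : realType}.
Implicit Types (f g h u E psi : R -> R).
Local Notation mu := (@lebesgue_measure R).

Lemma test_function_support psi : test_function psi ->
  exists N : R, forall x, N < `|x| -> psi x = 0.
Proof.
move=> [_ /compact_bounded[M [_ /(_ (M + 1) (ltr_pwDr ltr01 (lexx _))) MK]]].
exists (M + 1) => x; apply: contraTeq => psi0.
by rewrite -leNgt; apply: MK; exact: subset_closure.
Qed.

Lemma compact_support_test_function psi (N : R) :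
  infinitely_derivable psi -> (forall x, N < `|x| -> psi x = 0) ->
  test_function psi.
Proof.
move=> spsi psi0; split=> //.
apply: (@subclosed_compact _ _ `[- N, N]%classic).
- exact: closed_closure.
- exact: segment_compact.
- rewrite [X in _ `<=` X](closure_id _).1; last exact: interval_closed.
  apply: closureS => x /=; apply: contra_neqP.
  by move/negP; rewrite in_itv/= -ler_norml -ltNge; exact: psi0.
Qed.

Lemma derive1_compact_support psi (N : R) :
  (forall x, N < `|x| -> psi x = 0) -> forall x, N < `|x| -> derive1 psi x = 0.
Proof.
move=> psi0 x Nx; rewrite derive1E (@near_eq_derive _ _ _ _ (cst 0)).
  exact: derive_cst.
have : \forall y \near x, N < `|y|.
  have : `|y| @[y --> x] --> `|x| by exact: norm_continuous.
  by move=> /cvgr_gt; apply.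
by apply: filterS => y; exact: psi0.
Qed.

(** For a test function psi, E psi is again a test function, and
    E psi' = (E psi)' - E' psi; the weak derivative of f is only ever applied
    to E psi. *)
Lemma weak_derivativeM f g E :
  locally_integrable setT f -> locally_integrable setT g ->
  weak_derivative f g -> infinitely_derivable E ->
  weak_derivative (fun x => f x * E x) (fun x => g x * E x + f x * derive1 E x).
Proof.
move=> lf lg wfg sE psi tpsi.
have [N psi0] := test_function_support tpsi.
have spsi : infinitely_derivable psi by case: tpsi.
have cE := infinitely_derivable_continuous sE.
have cE' := infinitely_derivable_continuous (infinitely_derivable_derive1 sE).
have cpsi := infinitely_derivable_continuous spsi.
have cpsi' := infinitely_derivable_continuous (infinitely_derivable_derive1 spsi).
have dEpsi x : derive1 (fun y => E y * psi y) x =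
    E x * derive1 psi x + psi x * derive1 E x.
  rewrite [LHS]derive1E.
  have := is_deriveM (infinitely_derivable_is_derive sE x)
    (infinitely_derivable_is_derive spsi x).
  by move=> /@derive_val.
have tEpsi : test_function (fun x => E x * psi x).
  apply: (@compact_support_test_function _ N); first exact: infinitely_derivableM.
  by move=> x /psi0 ->; rewrite mulr0.
have int1 : mu.-integrable setT
    (EFin \o (fun x => f x * (E x * derive1 psi x))).
  apply: (@integrable_locally_compact_support _ _ _ N) => //.
    by move=> x; apply: continuousM; [exact: cE|exact: cpsi'].
  by move=> x /(derive1_compact_support psi0) ->; rewrite mulr0.
have int2 : mu.-integrable setT
    (EFin \o (fun x => f x * (psi x * derive1 E x))).
  apply: (@integrable_locally_compact_support _ _ _ N) => //.
    by move=> x; apply: continuousM; [exact: cpsi|exact: cE'].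
  by move=> x /psi0 ->; rewrite mul0r.
have int3 : mu.-integrable setT (EFin \o (fun x => g x * (E x * psi x))).
  apply: (@integrable_locally_compact_support _ _ _ N) => //.
    by move=> x; apply: continuousM; [exact: cE|exact: cpsi].
  by move=> x /psi0 ->; rewrite mulr0.
have := wfg _ tEpsi.
under eq_Rintegral do rewrite dEpsi mulrDr.
rewrite RintegralD// => eq1.
under eq_Rintegral do rewrite -mulrA.
under [in RHS]eq_Rintegral do rewrite mulrDl -!mulrA (mulrC (derive1 E _)).
rewrite RintegralD// opprD -eq1.
by rewrite addrK.
Qed.

End weak_derivative_extra.

(** * A weak derivative is the density of a primitive *)

Section smooth_step_theory.
Context {R : realType}.
Implicit Types (u h : R -> R) (a b x : R).
Local Notation mu := (@lebesgue_measure R).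

Lemma derive1_smooth_step_out x : (x < 0) || (1 < x) ->
  derive1 (@smooth_step R) x = 0.
Proof.
move=> /orP[x0|x1]; rewrite derive1E.
- rewrite (@near_eq_derive R R^o R^o _ (cst 0)) ?derive_cst//.
  near=> y; apply: smooth_step0; apply: ltW; near: y; exact: lt_nbhsl.
- rewrite (@near_eq_derive R R^o R^o _ (cst 1)) ?derive_cst//.
  near=> y; apply: smooth_step1; apply: ltW; near: y; exact: lt_nbhsr.
Unshelve. all: by end_near. Qed.

Lemma derive1_smooth_step_bounded :
  exists2 K : R, 0 < K & forall x, `|derive1 (@smooth_step R) x| <= K.
Proof.
have : compact (derive1 (@smooth_step R) @` `[0, 1]).
  apply: continuous_compact; last exact: segment_compact.
  apply: continuous_subspaceT; apply: infinitely_derivable_continuous.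
  exact/infinitely_derivable_derive1/infinitely_derivable_smooth_step.
move=> /compact_bounded[M [_ kM]]; exists (`|M| + 1) => [|x].
  by rewrite ltr_wpDl.
have [x01|] := boolP (x \in `[0, 1]).
  by apply: kM; [rewrite ltr_pwDr// ler_norm|exists x].
rewrite in_itv/= negb_and -!ltNge => /derive1_smooth_step_out ->.
by rewrite normr0 addr_ge0.
Qed.

Lemma is_derive_affine (c a x : R) :
  is_derive x 1 (fun y : R => c * (y - a)) c.
Proof.
have : is_derive x 1 (c *: ((@id R : R -> R^o) - cst a)) (c *: (1 - 0)).
  exact: is_deriveZ.
by move/is_derive_eq; apply; rewrite subr0 /GRing.scale/= mulr1.
Qed.

(** A smooth step climbing from 0 to 1 on [a, a + 1/(n+1)]. *)
Definition step_at a (n : nat) x : R := smooth_step (n.+1%:R * (x - a)).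

Lemma infinitely_derivable_step_at a n : infinitely_derivable (step_at a n).
Proof.
apply: smooth_closureP.
apply: (@smooth_closure_comp _ (@smooth_step R) (fun x => n.+1%:R * (x - a))).
  exact/smooth_closure_base/infinitely_derivable_smooth_step.
apply: smooth_closure_base.
apply: (@infinitely_derivableS _ _ (cst n.+1%:R)) => [x|].
  exact: is_derive_affine.
exact: infinitely_derivable_cst.
Qed.

Lemma derive1_step_at a n x :
  derive1 (step_at a n) x = n.+1%:R * derive1 (@smooth_step R) (n.+1%:R * (x - a)).
Proof.
rewrite derive1E.
have dl := is_derive_affine n.+1%:R a x.
have ds := infinitely_derivable_is_derive (@infinitely_derivable_smooth_step R)
  (n.+1%:R * (x - a)).
have := @is_derive1_comp _ (@smooth_step R) (fun x => n.+1%:R * (x - a)) _ _ _ ds dl.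
by move=> /@derive_val; rewrite mulrC.
Qed.

Lemma step_at_le a n x : x <= a -> step_at a n x = 0.
Proof. by move=> xa; apply: smooth_step0; rewrite pmulr_rle0// subr_le0. Qed.

Lemma step_at_ge a n x : a + n.+1%:R^-1 <= x -> step_at a n x = 1.
Proof.
move=> ax; apply: smooth_step1.
by rewrite -ler_pdivrMl// mulr1 lerBrDl.
Qed.

Lemma derive1_step_at_out a n x : x \notin `[a, a + n.+1%:R^-1] ->
  derive1 (step_at a n) x = 0.
Proof.
rewrite in_itv/= negb_and -!ltNge derive1_step_at => xa.
rewrite derive1_smooth_step_out ?mulr0//.
rewrite pmulr_rlt0// subr_lt0; case/orP : xa => [->//|xa].
by rewrite -ltr_pdivrMl// mulr1 ltrBrDl xa orbT.
Qed.

(** The derivative of the step has mass 1 and lives on [a, a + 1/(n+1)], where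
    u is close to u a.  It is bounded by K (n+1) while its support has length
    1/(n+1), so the error is at most K times the oscillation of u there. *)
Lemma cvg_smooth_step_mollifier u a : continuous u ->
  \int[mu]_x (u x * derive1 (step_at a n) x) @[n --> \oo] --> u a.
Proof.
move=> cu; have [K K0 sK] := derive1_smooth_step_bounded.
apply/cvgrPdist_le => e e0.
have /cvgrPdist_le/(_ (e / K)) := cu a.
rewrite divr_gt0// => /(_ isT) /nbhs_ballP[d /= d0 ud].
near=> n.
have nd : n.+1%:R^-1 < d.
  by near: n; exact: (near_infty_natSinv_lt (PosNum d0)).
set I := `[a, a + n.+1%:R^-1]%classic.
set k : R -> R := derive1 (step_at a n).
have ck : continuous k.
  apply/infinitely_derivable_continuous/infinitely_derivable_derive1.
  exact: infinitely_derivable_step_at.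
have aI : a < a + n.+1%:R^-1 by rewrite ltrDl.
have intk (v : R -> R) : continuous v ->
    mu.-integrable I (EFin \o (fun x => v x * k x)).
  move=> cv; apply: (@locally_integrable_itv _ _ _ a (a + n.+1%:R^-1)) => //.
  by apply: locally_integrableMc ck; exact: continuous_locally_integrable.
have mI : measurable I by exact: measurable_itv.
have intck (c : R) : mu.-integrable I (EFin \o (fun x => c * k x)).
  by apply: (intk (cst c)); exact: cst_continuous.
have -> : \int[mu]_x (u x * k x) = \int[mu]_(x in I) (u x * k x).
  rewrite [RHS]Rintegral_mkcond; apply: eq_Rintegral => x _.
  rewrite patchE; case: ifPn => //; rewrite notin_setE/= => /negP xI.
  by rewrite /k derive1_step_at_out ?mulr0.
have -> : u a = \int[mu]_(x in I) (u a * k x).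
  rewrite RintegralZl//; last first.
    by apply: eq_integrable (intck 1) => // x _ /=; rewrite mul1r.
  rewrite /Rintegral (@continuous_FTC2 _ k (step_at a n))//.
  - by rewrite /= step_at_ge// step_at_le// subr0 mulr1.
  - exact: continuous_subspaceT.
  - have sd := @infinitely_derivable_step_at a n.
    split.
    + by move=> x _; exact: (sd 0%N).
    + by apply: cvg_at_right_filter; exact: infinitely_derivable_continuous.
    + by apply: cvg_at_left_filter; exact: infinitely_derivable_continuous.
rewrite -RintegralB//; last exact: intk.
under eq_Rintegral do rewrite -mulrBl.
have cau : continuous (fun x => u a - u x).
  by move=> x; apply: cvgB; [exact: cvg_cst|exact: cu].
apply: le_trans (le_normr_Rintegral _ (intk _ cau)) _ => //.
have -> : e = \int[mu]_(x in I) (e * n.+1%:R).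
  rewrite Rintegral_cst// /I/= lebesgue_measure_itv/= lte_fin aI.
  by rewrite -EFinB/= addrAC subrr add0r mulfK.
apply: le_Rintegral => //.
- exact: (integrable_norm (intk _ cau)).
- apply: continuous_compact_integrable; first exact: segment_compact.
  by apply: continuous_subspaceT => x; exact: cst_continuous.
move=> x; rewrite /I/= in_itv/= => /andP[ax xan].
rewrite normrM /k derive1_step_at normrM normr_nat mulrCA mulrC ler_wpM2r//.
rewrite -[leRHS](divfK (lt0r_neq0 K0)) ler_pM//.
apply: ud; rewrite /ball/= distrC ger0_norm ?subr_ge0//.
by rewrite ltrBlDl (le_lt_trans xan)// ltrD2l.
Unshelve. all: by end_near. Qed.

(** The test function, a step at a minus a step at b, tends to the indicator
    function of ]a, b], and its derivative tends to the Dirac mass at a minus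
    the Dirac mass at b. *)
Lemma weak_derivative_FTC u h a b : a < b ->
  continuous u -> locally_integrable setT h -> weak_derivative u h ->
  u b - u a = \int[mu]_(x in `]a, b]) h x.
Proof.
move=> ab cu lh wuh.
pose psi n x := step_at a n x - step_at b n x.
(* [- N, N] contains the supports of all the psi n. *)
pose N : R := `|a| + `|b| + 1.
have nN n x : N < `|x| -> psi n x = 0.
  have n1 : n.+1%:R^-1 <= 1 :> R by rewrite invf_le1// ler1n.
  rewrite /psi => Nx.
  have [x0|x0] := leP 0 x.
    move: Nx; rewrite (ger0_norm x0) => Nx.
    have := ler_norm a; have := ler_norm b.
    have := normr_ge0 a; have := normr_ge0 b; rewrite /N in Nx.
    have step1 c : c + 1 <= x -> step_at c n x = 1.
      by move=> cx; rewrite step_at_ge// (le_trans _ cx)// lerD2l.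
    by move=> *; rewrite !step1 ?subrr//; lra.
  move: Nx; rewrite (ltr0_norm x0) => Nx.
  have := ler_norm (- a); have := ler_norm (- b); rewrite !normrN.
  have := normr_ge0 a; have := normr_ge0 b; rewrite /N in Nx.
  by move=> *; rewrite !step_at_le ?subrr//; lra.
have dpsi n x : is_derive x 1 (psi n)
    (derive1 (step_at a n) x - derive1 (step_at b n) x).
  apply: is_deriveB; apply: infinitely_derivable_is_derive;
    exact: infinitely_derivable_step_at.
have spsi n : infinitely_derivable (psi n).
  have -> : psi n = fun x => step_at a n x + cst (-1) x * step_at b n x.
    by apply/funext => x; rewrite mulN1r.
  apply: smooth_closureP; apply: smooth_closureD.
    exact/smooth_closure_base/infinitely_derivable_step_at.
  apply: smooth_closureM; apply: smooth_closure_base.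
    exact: infinitely_derivable_cst.
  exact: infinitely_derivable_step_at.
have psi1 n x : `|psi n x| <= 1.
  have /andP[? ?] := smooth_step_itv (n.+1%:R * (x - a)).
  have /andP[? ?] := smooth_step_itv (n.+1%:R * (x - b)).
  by rewrite /psi/= /step_at ler_norml; apply/andP; split; lra.
have psi_lim x : (x \in `]a, b] -> \forall n \near \oo, psi n x = 1) /\
    (x \notin `]a, b] -> \forall n \near \oo, psi n x = 0).
  have ge1 c : c < x -> \forall n \near \oo, step_at c n x = 1.
    rewrite -subr_gt0 => cx.
    apply: filterS (near_infty_natSinv_lt (PosNum cx)) => n /= nx.
    by apply: step_at_ge; rewrite -lerBrDl ltW.
  rewrite in_itv/=; split.
    move=> /andP[/ge1 + xb]; apply: filterS => n.
    by rewrite /psi => ->; rewrite step_at_le// subr0.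
  rewrite negb_and -leNgt -ltNge => /orP[xa|bx].
    apply: nearW => n; rewrite /psi !step_at_le ?subrr//.
    by rewrite (le_trans xa)// ltW.
  apply: filterS2 (ge1 _ bx) (ge1 _ (lt_trans ab bx)) => n.
  by rewrite /psi => -> ->; rewrite subrr.
have A n : \int[mu]_x (u x * derive1 (psi n) x) =
    \int[mu]_x (u x * derive1 (step_at a n) x) -
    \int[mu]_x (u x * derive1 (step_at b n) x).
  have intk c : mu.-integrable setT
      (EFin \o (fun x => u x * derive1 (step_at c n) x)).
    apply: (@integrable_locally_compact_support _ _ _ (`|c| + 1)).
    - exact: continuous_locally_integrable.
    - apply/infinitely_derivable_continuous/infinitely_derivable_derive1.
      exact: infinitely_derivable_step_at.
    - move=> x cx; apply: derive1_step_at_out.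
      apply: contraL cx; rewrite in_itv/= -leNgt ler_norml.
      have n1 : n.+1%:R^-1 <= 1 :> R by rewrite invf_le1// ler1n.
      have := ler_norm c; have := ler_norm (- c); rewrite normrN.
      move: n1; move: (n.+1%:R^-1) => r r1 ? ? /andP[? ?].
      by apply/andP; split; lra.
  rewrite -RintegralB//; apply: eq_Rintegral => x _.
  by rewrite -mulrBr derive1E derive_val.
have cA : \int[mu]_x (u x * derive1 (psi n) x) @[n --> \oo] --> u a - u b.
  under eq_cvg do rewrite A.
  by apply: cvgB; exact: cvg_smooth_step_mollifier.
have cB : \int[mu]_x (h x * psi n x) @[n --> \oo] --> \int[mu]_(x in `]a, b]) h x.
  have -> : \int[mu]_(x in `]a, b]) h x = \int[mu]_x (h \_ `]a, b]%classic) x.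
    by rewrite Rintegral_mkcond.
  apply: fine_cvg; rewrite fineK; last first.
    apply: integrable_fin_num => //.
    have : mu.-integrable `]a, b] (EFin \o h).
      apply: (@locally_integrable_itv _ _ _ a b) => //.
      by move=> x /=; rewrite !in_itv/= => /andP[/ltW -> ->].
    move=> hab; have : mu.-integrable setT ((EFin \o h) \_ `]a, b]).
      by rewrite -integrable_mkcond.
    by rewrite restrict_EFin.
  have mh : measurable_fun setT h by case: lh.
  pose G := (EFin \o (fun x => `|h x|)) \_ `[- N, N]%classic.
  have [//|||||_ _] := @dominated_convergence _ _ _ mu setT measurableT
    (fun n => EFin \o (fun x => h x * psi n x)) (EFin \o (h \_ `]a, b]%classic)) G.
  - move=> n; apply/measurable_EFinP; apply: measurable_funM => //.
    apply: continuous_measurable_fun.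
    exact: infinitely_derivable_continuous (spsi n).
  - by apply/measurable_EFinP; apply/(measurable_restrictT _ _).1 => //;
      exact: measurable_funS mh.
  - apply: aeW => x _ /=; apply: cvg_EFin; first by apply: nearW.
    apply: cvg_near_cst; have [near1 near0] := psi_lim x.
    rewrite /= patchE; case: ifPn; rewrite ?notin_setE ?inE/= => xab.
      by apply: filterS (near1 xab) => n ->; rewrite mulr1.
    by move/negP: xab => /near0; apply: filterS => n ->; rewrite mulr0.
  - rewrite -integrable_mkcond//.
    apply: integrable_norm.
    exact: (locally_integrable_itv lh (@subset_refl _ _)).
  - apply: aeW => x n _ /=; rewrite /G patchE; case: ifPn => [_|].
      by rewrite lee_fin normrM ler_piMr.
    rewrite notin_setE/= in_itv/= => /negP; rewrite -ler_norml -ltNge => /nN ->.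
    by rewrite mulr0 normr0.
  by [].
have tpsi n : test_function (psi n).
  by apply: (@compact_support_test_function _ _ N); [exact: spsi|exact: nN].
have : u a - u b = - \int[mu]_(x in `]a, b]) h x.
  apply: (cvg_unique _ cA); first exact: Rhausdorff.
  rewrite /=; under eq_cvg do rewrite (wuh _ (tpsi _)).
  exact: cvgN.
by move=> /eqP; rewrite -eqr_oppLR opprB => /eqP.
Qed.

End smooth_step_theory.

(** * The Maxwellian *)

Section maxwellian_theory.
Context {R : realType}.
Implicit Types (V w x t : R).
Local Notation mu := (@lebesgue_measure R).

Lemma maxwellianE V : maxwellian V = normal_pdf V 1.
Proof.
apply/funext => w; rewrite normal_pdfE ?oner_eq0// /normal_peak /normal_fun.
rewrite /maxwellian (_ : 1 ^+ 2 * pi *+ 2 = 2 * pi); last first.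
  by rewrite expr1n mul1r mulr_natl.
by congr (_ * expR _); rewrite expr1n mulNr mul1r mulNr mulrC.
Qed.

Lemma maxwellian_gt0 V w : 0 < maxwellian V w.
Proof.
by rewrite /maxwellian mulr_gt0 ?expR_gt0// invr_gt0 sqrtr_gt0 mulr_gt0// pi_gt0.
Qed.

Lemma continuous_maxwellian V : continuous (maxwellian V).
Proof. by rewrite maxwellianE; apply: continuous_normal_pdf; rewrite oner_eq0. Qed.

Lemma integrable_maxwellian V : mu.-integrable setT (EFin \o maxwellian V).
Proof. by rewrite maxwellianE; exact: integrable_normal_pdf. Qed.

Lemma integral_maxwellian V : (\int[mu]_x (maxwellian V x)%:E = 1)%E.
Proof. by rewrite maxwellianE; exact: integral_normal_pdf. Qed.

Lemma maxwellianN V w : maxwellian V (- w) = maxwellian (- V) w.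
Proof. by rewrite /maxwellian -opprD sqrrN opprK. Qed.

Lemma is_derive_maxwellian V w :
  is_derive w 1 (maxwellian V) (- ((w - V) * maxwellian V w)).
Proof.
have dq : is_derive w 1 (fun x : R => - (1 / 2) * (x - V) ^+ 2) (- (w - V)).
  have dl : is_derive w 1 (fun x : R => x - V) 1.
    have := @is_deriveB R R^o R^o id (cst V) w 1 _ _
      (is_derive_id _ _) (is_derive_cst _ _ _).
    by move/is_derive_eq; apply; rewrite subr0.
  have dX : is_derive w 1 (fun x : R => (x - V) ^+ 2) (2%:R * (w - V)).
    have := @is_deriveX R R^o (fun x : R => x - V) 2 w 1 _ dl.
    rewrite -[_ *: _]/(_ * _)%R mulr1.
    by congr is_derive; apply/funext => y; rewrite exprfctE.
  have := @is_deriveZ R R^o R^o _ (- (1 / 2)) w 1 _ dX.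
  by move/is_derive_eq; apply; rewrite -![_ *: _]/(_ * _)%R; field.
have dE := @is_derive1_comp _ expR (fun x : R => - (1 / 2) * (x - V) ^+ 2)
  _ _ _ (is_derive_expR _) dq.
have := is_deriveZ (Num.sqrt (2 * pi))^-1 dE.
move/is_derive_eq; apply.
by rewrite -![_ *: _]/(_ * _)%R /maxwellian; ring.
Qed.

Lemma cvg_maxwellian V : maxwellian V x @[x --> +oo] --> 0.
Proof.
rewrite -[X in _ --> X](mulr0 (Num.sqrt (2 * pi))^-1).
apply: cvgM; first exact: cvg_cst.
under eq_cvg do rewrite mulNr.
apply: (@cvg_comp _ _ _ (fun x => 1 / 2 * (x - V) ^+ 2) (fun y => expR (- y)) _ +oo).
  apply/cvgryPge => A; near=> x.
  have x1 : 1 <= x - V.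
    by rewrite lerBrDl; near: x; apply: nbhs_pinfty_ge; rewrite num_real.
  have xA : 2 * A <= x - V.
    by rewrite lerBrDl; near: x; apply: nbhs_pinfty_ge; rewrite num_real.
  rewrite expr2; nra.
exact: cvgr_expR.
Unshelve. all: by end_near. Qed.

(** - M is a primitive of the integrand, and M vanishes at infinity. *)
Lemma maxwellian_first_moment_ge V t : V <= t ->
  (\int[mu]_(x in `[t, +oo[) ((x - V) * maxwellian V x)%:E = (maxwellian V t)%:E)%E.
Proof.
move=> Vt.
have cM := @continuous_maxwellian V.
have cl : continuous (fun x : R => x - V).
  by move=> x; apply: cvgB; [exact: cvg_id|exact: cvg_cst].
have clM : continuous (fun x : R => (x - V) * maxwellian V x).
  by move=> x; exact: (cvgM (cl x) (cM x)).
rewrite (@ge0_continuous_FTC2y _ _ (fun x => - maxwellian V x) _ 0).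
- by rewrite EFinN oppeK add0e.
- move=> x tx; rewrite mulr_ge0 ?subr_ge0 ?(le_trans Vt)//.
  exact/ltW/maxwellian_gt0.
- exact: continuous_subspaceT.
- by rewrite -oppr0; apply: cvgN; exact: cvg_maxwellian.
- by move=> x _; have [] := is_deriveN (is_derive_maxwellian V x).
- by apply: cvg_at_right_filter; apply: cvgN; exact: cM.
- move=> x _; rewrite derive1E.
  by have /@derive_val -> := is_deriveN (is_derive_maxwellian V x); rewrite opprK.
Qed.

(** The mirror image x |-> - x turns V into - V. *)
Lemma maxwellian_first_moment_le V t : t <= V ->
  (\int[mu]_(x in `]-oo, t]) ((V - x) * maxwellian V x)%:E = (maxwellian V t)%:E)%E.
Proof.
move=> tV.
have cM : continuous (fun x : R => (V - x) * maxwellian V x).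
  move=> x; apply: cvgM; last exact: continuous_maxwellian.
  by apply: cvgB; [exact: cvg_cst|exact: cvg_id].
rewrite -(opprK t) ge0_integration_by_substitutionNy.
- rewrite opprK.
  under eq_integral => x _.
    rewrite /= maxwellianN opprK [V + x]addrC -[X in x + X]opprK; over.
  by rewrite maxwellian_first_moment_ge ?lerN2// -maxwellianN opprK.
- exact: continuous_subspaceT.
- move=> x; rewrite in_itv/= opprK => xt.
  by rewrite mulr_ge0 ?subr_ge0 ?(le_trans (ltW xt))// ltW// maxwellian_gt0.
Qed.

Lemma infinitely_derivable_inv_maxwellian (V : R) :
  infinitely_derivable (fun w => (maxwellian V w)^-1).
Proof.
have cstP c : smooth_closure (cst c : R -> R).
  exact/smooth_closure_base/infinitely_derivable_cst.
have idP := smooth_closure_base (@infinitely_derivable_id R).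
have lP : smooth_closure (fun w : R => w - V).
  exact: (@smooth_closureD _ id (cst (- V))).
have qP : smooth_closure (fun w : R => - (1 / 2) * ((w - V) * (w - V))).
  apply: (@smooth_closureM _ (cst (- (1 / 2)))) => //.
  exact: smooth_closureM.
apply: smooth_closureP; apply: smooth_closureV; last first.
  by move=> w; rewrite gt_eqF// maxwellian_gt0.
apply: (@smooth_closureM _ (cst (Num.sqrt (2 * pi))^-1)) => //.
apply: (@smooth_closure_comp _ expR); last exact: qP.
exact/smooth_closure_base/infinitely_derivable_expR.
Qed.

End maxwellian_theory.

(** * Hardy and Poincare inequalities for the Gaussian weight *)

Section gaussian_poincare.
Context {R : realType}.
Implicit Types (u h : R -> R) (V a b x : R).
Local Notation mu := (@lebesgue_measure R).

(** Cauchy-Schwarz on an interval, obtained from the nonnegative integral of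
    (h - m)^2 with m the mean of h.  The right-hand side may be infinite. *)
Lemma sqr_Rintegral_le h a b : measurable_fun setT h ->
  a < b -> mu.-integrable `]a, b] (EFin \o h) ->
  (((\int[mu]_(x in `]a, b]) h x) ^+ 2)%:E <=
   (b - a)%:E * \int[mu]_(x in `]a, b]) (h x ^+ 2)%:E)%E.
Proof.
move=> mh ab inth; set I := `]a, b]%classic.
have mI : @measurable _ (measurableTypeR R) I by exact: measurable_itv.
have ba0 : 0 < b - a by rewrite subr_gt0.
have mh2 : measurable_fun I (fun x => h x ^+ 2).
  by apply: measurable_funX; exact: measurable_funS mh.
have [hoo|hfin] := eqVneq (\int[mu]_(x in I) (h x ^+ 2)%:E)%E +oo%E.
  by rewrite hoo gt0_muley ?lte_fin// leey.
have int2 : mu.-integrable I (EFin \o (fun x => h x ^+ 2)).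
  apply/integrableP; split; first exact/measurable_EFinP.
  under eq_integral do rewrite /= ger0_norm ?sqr_ge0//.
  by rewrite ltey.
have intc (c : R) : mu.-integrable I (EFin \o cst c).
  apply: (@locally_integrable_itv _ (cst c) _ a b).
    by apply: continuous_locally_integrable => x; exact: cst_continuous.
  by move=> x /=; rewrite !in_itv/= => /andP[/ltW -> ->].
have -> : (\int[mu]_(x in I) (h x ^+ 2)%:E)%E = (\int[mu]_(x in I) (h x ^+ 2))%:E.
  by rewrite /Rintegral fineK//; exact: integrable_fin_num.
rewrite -EFinM lee_fin.
pose m := (\int[mu]_(x in I) h x) / (b - a).
have mE : \int[mu]_(x in I) h x = m * (b - a) by rewrite /m divfK ?gt_eqF.
have : 0 <= \int[mu]_(x in I) ((h x - m) ^+ 2).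
  by apply: Rintegral_ge0 => x _; exact: sqr_ge0.
have intm : mu.-integrable I (EFin \o (fun x => (- (2 * m)) * h x)).
  exact: (integrableZl mI _ inth).
have -> : \int[mu]_(x in I) ((h x - m) ^+ 2) =
    \int[mu]_(x in I) ((h x ^+ 2 + (- (2 * m)) * h x) + m ^+ 2).
  by apply: eq_Rintegral => x _; ring.
rewrite RintegralD//; last 2 first.
  exact: (integrableD mI int2 intm).
  exact: intc.
rewrite RintegralD// RintegralZl// mE Rintegral_cst// /I/= lebesgue_measure_itv/=.
rewrite lte_fin ab -EFinB/=.
rewrite -/I; set H := \int[mu]_(x in I) (h x ^+ 2) => H0.
have : 0 <= H - m ^+ 2 * (b - a) by lra.
rewrite subr_ge0 => mH.
have -> : (m * (b - a)) ^+ 2 = (b - a) * (m ^+ 2 * (b - a)) by ring.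
by rewrite ler_wpM2l// ltW.
Qed.

(** Hardy inequality: after Cauchy-Schwarz between V and x, exchange the
    integrals of the kernel h(t)^2 |x - V| M(x) over the pairs (x, t) with t
    between V and x; the slice at a given t is a first moment of M, whose value
    is M(t). *)
Lemma gaussian_hardy V u h : measurable_fun setT u ->
  locally_integrable setT h ->
  (forall a b, a < b -> u b - u a = \int[mu]_(x in `]a, b]) h x) ->
  (\int[mu]_x ((u x - u V) ^+ 2 * maxwellian V x)%:E <=
   \int[mu]_x (h x ^+ 2 * maxwellian V x)%:E)%E.
Proof.
move=> mu_u lh uh; have mh : measurable_fun setT h by case: lh.
have mM : measurable_fun setT (maxwellian V).
  by apply: continuous_measurable_fun; exact: continuous_maxwellian.
have M0 x : 0 <= maxwellian V x by exact/ltW/maxwellian_gt0.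
(* The half-open intervals ]V, x] and ]x, V] are those of the primitive u. *)
pose between (z : R * R) :=
  ((V < z.2) && (z.2 <= z.1)) || ((z.1 < z.2) && (z.2 <= V)).
pose k (z : R * R) : R :=
  if between z then h z.2 ^+ 2 * (`|z.1 - V| * maxwellian V z.1) else 0.
have k0 z : 0 <= k z.
  by rewrite /k; case: ifP => // _; rewrite mulr_ge0 ?sqr_ge0// mulr_ge0.
have mh2 : measurable_fun setT (fun x => (h x ^+ 2)%:E).
  by apply/measurable_EFinP; exact: measurable_funX.
have mlM : measurable_fun setT (fun x => (`|x - V| * maxwellian V x)%:E).
  apply/measurable_EFinP; apply: measurable_funM => //.
  by apply: measurableT_comp => //; exact: measurable_funB.
have mk : measurable_fun [set: R * R] (EFin \o k).
  apply/measurable_EFinP; apply: measurable_fun_ifT => //.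
  - apply: measurable_or; apply: measurable_and.
    + exact: measurable_fun_ltr.
    + exact: measurable_fun_ler.
    + exact: measurable_fun_ltr.
    + exact: measurable_fun_ler.
  - apply: measurable_funM; last first.
      by apply/measurable_EFinP; exact: (measurableT_comp mlM).
    by apply/measurable_EFinP; exact: (measurableT_comp mh2).
have slice (A : set (measurableTypeR R)) (f : R -> R) (c : R) (g : R -> R) :
    measurable A -> measurable_fun setT f -> (forall x, A x -> 0 <= f x) ->
    0 <= c -> (forall x, g x = if x \in A then f x * c else 0) ->
    (\int[mu]_x (g x)%:E = c%:E * \int[mu]_(x in A) (f x)%:E)%E.
  move=> mA mf f0 c0 gE.
  rewrite -ge0_integralZl_EFin//; last first.
    by apply/measurable_EFinP; exact: measurable_funS mf.
  rewrite [RHS]integral_mkcond; apply: eq_integral => x _.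
  by rewrite gE patchE; case: ifPn => //; rewrite -EFinM mulrC.
have lower x : (((u x - u V) ^+ 2 * maxwellian V x)%:E <=
    \int[mu]_t (EFin \o k) (x, t))%E.
  have key a b (m : R) : 0 < m -> a < b ->
      (((u b - u a) ^+ 2 * m)%:E <=
       ((b - a) * m)%:E * \int[mu]_(t in `]a, b]) (h t ^+ 2)%:E)%E.
    move=> m0 ab; rewrite mulrC EFinM (mulrC (b - a)) (EFinM m (b - a)).
    rewrite -muleA lee_pmul2l//.
    rewrite uh//; apply: sqr_Rintegral_le => //.
    apply: (@locally_integrable_itv _ _ _ a b) => //.
    by move=> t /=; rewrite !in_itv/= => /andP[/ltW -> ->].
  have [xV|Vx|->] := ltgtP x V.
  - rewrite -[(u x - u V)]opprB sqrrN.
    apply: le_trans (key _ _ _ (maxwellian_gt0 V x) xV) _.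
    rewrite (@slice `]x, V]%classic (fun t => h t ^+ 2)
      ((V - x) * maxwellian V x))//.
    + by apply: measurable_funX.
    + by move=> t _; exact: sqr_ge0.
    + by rewrite mulr_ge0// subr_ge0 ltW.
    + move=> t; rewrite /k /between/= mem_setE in_itv/=.
      rewrite (ltr0_norm (_ : x - V < 0)) ?subr_lt0// opprB.
      rewrite [V < t <= x](_ : _ = false)//; apply/negP.
      by move=> /andP[/(lt_trans xV)]; rewrite ltNge => /negP.
  - apply: le_trans (key _ _ _ (maxwellian_gt0 V x) Vx) _.
    rewrite (@slice `]V, x]%classic (fun t => h t ^+ 2)
      ((x - V) * maxwellian V x))//.
    + by apply: measurable_funX.
    + by move=> t _; exact: sqr_ge0.
    + by rewrite mulr_ge0// subr_ge0 ltW.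
    + move=> t; rewrite /k /between/= mem_setE in_itv/=.
      rewrite (gtr0_norm (_ : 0 < x - V)) ?subr_gt0//.
      rewrite [x < t <= V](_ : _ = false) ?orbF//; apply/negP.
      by move=> /andP[/(lt_trans Vx)]; rewrite ltNge => /negP.
  - rewrite subrr expr0n mul0r integral_ge0// => t _.
    by rewrite lee_fin.
have upper t : (\int[mu]_x (EFin \o k) (x, t) = (h t ^+ 2 * maxwellian V t)%:E)%E.
  have [tV|Vt] := leP t V.
  - rewrite (@slice `]-oo, t[%classic
      (fun x => (V - x) * maxwellian V x) (h t ^+ 2))//.
    + rewrite integral_itv_bndo_bndc ?maxwellian_first_moment_le//.
      apply/measurable_EFinP; apply: measurable_funM; first exact: measurable_funB.
      exact: measurable_funS mM.
    + by apply: measurable_funM => //; exact: measurable_funB.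
    + move=> x /=; rewrite in_itv/= => xt; rewrite mulr_ge0// subr_ge0.
      exact/ltW/(lt_le_trans xt).
    + exact: sqr_ge0.
    + move=> x; rewrite /k /between/= mem_setE in_itv/= tV ltNge tV/= andbT.
      case: ifPn => // xt; rewrite mulrC ltr0_norm ?opprB// subr_lt0.
      exact: lt_le_trans xt _.
  - rewrite (@slice `[t, +oo[%classic
      (fun x => (x - V) * maxwellian V x) (h t ^+ 2))//.
    + by rewrite maxwellian_first_moment_ge// ltW.
    + by apply: measurable_funM => //; exact: measurable_funB.
    + move=> x /=; rewrite in_itv/= andbT => tx; rewrite mulr_ge0// subr_ge0.
      exact/ltW/(lt_le_trans Vt).
    + exact: sqr_ge0.
    + move=> x; rewrite /k /between/= mem_setE in_itv/= andbT Vt/=.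
      rewrite (leNgt t V) Vt andbF orbF.
      case: ifPn => // tx; rewrite mulrC gtr0_norm// subr_gt0.
      exact: lt_le_trans Vt _.
under [leRHS]eq_integral => t _ do rewrite -upper.
rewrite -(@fubini_tonelli _ _ _ _ _ mu mu (EFin \o k))//.
apply: ge0_le_integral => //.
- by move=> x _; rewrite lee_fin mulr_ge0// sqr_ge0.
- apply/measurable_EFinP; apply: measurable_funM => //.
  by apply: measurable_funX; exact: measurable_funB.
- have mF := @measurable_fun_fubini_tonelli_F _ _ _ _ _ mu (EFin \o k) mk.
  by apply: mF => z; rewrite lee_fin.
Qed.

(** With c = u V, expand u^2 = (u - c)^2 + 2 c u - c^2: the middle term
    integrates to 0 and the last one to - c^2.  The Hardy inequality comes
    first because it yields the integrability of (u - c)^2 M. *)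
Lemma gaussian_poincare V u h : measurable_fun setT u ->
  locally_integrable setT h ->
  (forall a b, a < b -> u b - u a = \int[mu]_(x in `]a, b]) h x) ->
  mu.-integrable setT (EFin \o (fun x => u x * maxwellian V x)) ->
  \int[mu]_x (u x * maxwellian V x) = 0 ->
  (\int[mu]_x (u x ^+ 2 * maxwellian V x)%:E <=
   \int[mu]_x (h x ^+ 2 * maxwellian V x)%:E)%E.
Proof.
move=> mu_u lh uh intu u0; have hardy := gaussian_hardy V mu_u lh uh.
have [->|hfin] := eqVneq (\int[mu]_x (h x ^+ 2 * maxwellian V x)%:E)%E +oo%E.
  by rewrite leey.
apply: le_trans (hardy).
have mM : measurable_fun setT (maxwellian V).
  by apply: continuous_measurable_fun; exact: continuous_maxwellian.
have M0 x : 0 <= maxwellian V x by exact/ltW/maxwellian_gt0.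
set c := u V in hardy *.
have intv : mu.-integrable setT
    (EFin \o (fun x => (u x - c) ^+ 2 * maxwellian V x)).
  apply/integrableP; split.
    apply/measurable_EFinP; apply: measurable_funM => //.
    by apply: measurable_funX; exact: measurable_funB.
  have : (\int[mu]_x ((u x - c) ^+ 2 * maxwellian V x)%:E < +oo)%E.
    by apply: le_lt_trans hardy _; rewrite ltey.
  apply: le_lt_trans; rewrite le_eqVlt; apply/orP; left; apply/eqP.
  by apply: eq_integral => x _ /=; rewrite ger0_norm// mulr_ge0// sqr_ge0.
have int1 : mu.-integrable setT
    (EFin \o (fun x => (2 * c) * (u x * maxwellian V x))).
  exact: (integrableZl measurableT _ intu).
have int2 : mu.-integrable setT
    (EFin \o (fun x => (- c ^+ 2) * maxwellian V x)).
  exact: (integrableZl measurableT _ (integrable_maxwellian V)).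
have -> : (\int[mu]_x (u x ^+ 2 * maxwellian V x)%:E =
    \int[mu]_x ((u x - c) ^+ 2 * maxwellian V x)%:E +
    (\int[mu]_x ((2 * c) * (u x * maxwellian V x))%:E +
     \int[mu]_x ((- c ^+ 2) * maxwellian V x)%:E))%E.
  rewrite -integralD// -integralD//; last first.
    exact: (integrableD measurableT int1 int2).
  by apply: eq_integral => x _; rewrite -!EFinD; congr EFin; ring.
have -> : (\int[mu]_x ((2 * c) * (u x * maxwellian V x))%:E = 0)%E.
  under eq_integral do rewrite EFinM.
  rewrite integralZl//.
  have /fineK <- : (\int[mu]_x (u x * maxwellian V x)%:E)%E \is a fin_num.
    exact: integrable_fin_num.
  by rewrite -/(Rintegral mu setT _) u0 mule0.
under [X in (_ + (_ + X) <= _)%E]eq_integral do rewrite EFinM.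
rewrite integralZl//; last exact: integrable_maxwellian.
rewrite integral_maxwellian mule1 add0e.
by rewrite -[leRHS]adde0 leeD2l// lee_fin oppr_le0 sqr_ge0.
Qed.

End gaussian_poincare.

(** * Absolutely continuous functions *)

Section absolutely_continuous.
Context {R : realType}.
Implicit Types (f g : R -> R) (l r x : R).

Lemma abs_continuous_on_pair f l r : abs_continuous_on l r f ->
  forall e, 0 < e -> exists2 d, 0 < d & forall x y,
    l <= x -> x <= y -> y <= r -> y - x < d -> `|f y - f x| < e.
Proof.
move=> acf e /acf[d d0 fd]; exists d => // x y lx xy yr yxd.
have := fd 1%N (fun=> x) (fun=> y); rewrite !big_ord1; apply => //.
by move=> i j _ _ _; rewrite !ord1.
Qed.

Lemma AC_loc_continuous f : AC_loc f -> continuous f.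
Proof.
move=> acf x; apply/cvgrPdist_lt => e e0.
have x11 : x - 1 <= x + 1 by lra.
have [d d0 fd] := abs_continuous_on_pair (acf _ _ x11) e0.
near=> y.
have /andP[yd y1] : (`|x - y| < d) && (`|x - y| < 1).
  by apply/andP; split; near: y; apply: cvgr_dist_lt.
have [xy|yx] := leP x y.
  rewrite distrC; rewrite ler0_norm ?subr_le0// opprB in yd y1.
  by apply: fd => //; lra.
rewrite gtr0_norm ?subr_gt0// in yd y1.
by apply: fd => //; lra.
Unshelve. all: by end_near. Qed.

Lemma continuous_itv_bounded f l r : continuous f ->
  exists2 K : R, 0 < K & forall x, l <= x -> x <= r -> `|f x| <= K.
Proof.
move=> cf.
have : compact (f @` `[l, r]).
  apply: continuous_compact; last exact: segment_compact.
  exact: continuous_subspaceT.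
move=> /compact_bounded[M [_ fM]]; exists (`|M| + 1); first by rewrite ltr_wpDl.
move=> x lx xr; apply: (fM (`|M| + 1)); first by rewrite ltr_pwDr// ler_norm.
by exists x => //=; rewrite in_itv/= lx.
Qed.

Lemma AC_locM f g : AC_loc f -> AC_loc g -> AC_loc (fun x => f x * g x).
Proof.
move=> acf acg l r lr e e0.
have [F F0 fF] := continuous_itv_bounded l r (AC_loc_continuous acf).
have [G G0 gG] := continuous_itv_bounded l r (AC_loc_continuous acg).
have eG : 0 < e / 2 / G by rewrite !divr_gt0.
have eF : 0 < e / 2 / F by rewrite !divr_gt0.
have [d1 d10 fd] := acf _ _ lr _ eG.
have [d2 d20 gd] := acg _ _ lr _ eF.
exists (Num.min d1 d2); first by rewrite lt_min d10.
move=> n a b ab tab; rewrite lt_min.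
move=> /andP[/(fd _ _ _ ab tab) fab /(gd _ _ _ ab tab) gab].
apply: (@le_lt_trans _ _ (\sum_(i < n)
    (`|f (b i) - f (a i)| * G + F * `|g (b i) - g (a i)|))).
  apply: ler_sum => i _; have [lai aibi bir] := ab i.
  rewrite (_ : _ - _ = (f (b i) - f (a i)) * g (b i) +
    f (a i) * (g (b i) - g (a i))); last by ring.
  rewrite (le_trans (ler_normD _ _))// !normrM lerD//.
    by rewrite ler_wpM2l// gG// (le_trans lai).
  by rewrite ler_wpM2r// fF// (le_trans aibi).
rewrite big_split/= -mulr_suml -mulr_sumr [e]splitr ltrD//.
  by rewrite -ltr_pdivlMr.
by rewrite mulrC -ltr_pdivlMr.
Qed.

(** A bounded derivative makes f Lipschitz on compact intervals. *)
Lemma infinitely_derivable_AC_loc f : infinitely_derivable f -> AC_loc f.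
Proof.
move=> sf l r lr e e0.
have cf' := infinitely_derivable_continuous (infinitely_derivable_derive1 sf).
have [K K0 fK] := continuous_itv_bounded l r cf'.
have lip x y : l <= x -> x <= y -> y <= r -> `|f y - f x| <= K * (y - x).
  move=> lx xy yr.
  have df z : z \in `]x, y[%R -> is_derive z 1 f (derive1 f z).
    by move=> _; exact: infinitely_derivable_is_derive.
  have cf : {within `[x, y], continuous f}.
    by apply: continuous_subspaceT; exact: infinitely_derivable_continuous.
  have [z zxy ->] := MVT_segment xy df cf.
  move: zxy; rewrite in_itv/= => /andP[xz zy].
  rewrite normrM (ger0_norm (_ : 0 <= y - x)) ?subr_ge0//.
  by rewrite ler_wpM2r ?subr_ge0// fK// ?(le_trans lx)// (le_trans zy).
exists (e / K); first exact: divr_gt0.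
move=> n a b ab tab sab.
apply: (@le_lt_trans _ _ (\sum_(i < n) K * (b i - a i))).
  by apply: ler_sum => i _; have [lai aibi bir] := ab i; exact: lip.
by rewrite -mulr_sumr mulrC -ltr_pdivlMr.
Qed.

End absolutely_continuous.

(** * From the primitive to the pointwise derivative *)

Section almost_everywhere.
Context {R : realType}.
Local Notation mu := (@lebesgue_measure R).

(** Near a Lebesgue point x of h, u differs by the constant u (x - 1) from the
    primitive of h that starts at x - 1. *)
Lemma ae_derive1_primitive (u h : R -> R) : locally_integrable setT h ->
  (forall a b, a < b -> u b - u a = \int[mu]_(x in `]a, b]) h x) ->
  {ae mu, forall x, derive1 u x = h x}.
Proof.
move=> lh uh; move: (lh) => /lebesgue_differentiation.
apply: filterS; first exact: (ae_filter_ringOfSetsType mu).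
move=> x hx; have x1 : x < x + 1 by rewrite ltrDl.
have inth : mu.-integrable `]x - 1, x + 1] (EFin \o h).
  apply: (@locally_integrable_itv _ _ _ (x - 1) (x + 1)) => //.
  by move=> t /=; rewrite !in_itv/= => /andP[/ltW -> ->].
have xa : (BRight (x - 1) < BRight x)%O by rewrite bnd_simp/= ltrBlDr ltrDl.
have [dF dFE] := FTC1_lebesgue_pt x1 inth xa hx.
set F : R -> R := (fun y => _) in dF dFE.
have dFx : is_derive x 1 F (h x) by rewrite -dFE derive1E; exact/derivableP.
have duF : is_derive x 1 (fun y => u (x - 1) + F y) (h x).
  have := is_deriveD (is_derive_cst (u (x - 1)) x 1) dFx.
  by move/is_derive_eq; apply; rewrite add0r.
have uF : \forall y \near x, u (x - 1) + F y = u y.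
  near=> y; have xy : x - 1 < y.
    by near: y; apply: lt_nbhsr; rewrite ltrBlDr ltrDl.
  by rewrite /F -uh// addrC subrK.
by rewrite derive1E; have [_ ->] := near_eq_is_derive uF duF.
Unshelve. all: by end_near. Qed.

(** A pointwise derivative may fail to be measurable, so g ranges over arbitrary
    nonnegative functions: the integral is a supremum over the simple functions
    below the integrand, hence monotone, and the null set is absorbed by
    modifying f. *)
Lemma ge0_le_integral_ae (f g : R -> \bar R) : measurable_fun setT f ->
  (forall x, 0 <= f x)%E -> (forall x, 0 <= g x)%E ->
  {ae mu, forall x, (f x <= g x)%E} ->
  (\int[mu]_x f x <= \int[mu]_x g x)%E.
Proof.
move=> mf f0 g0 [N [mN N0 fgN]].
rewrite (ge0_negligible_integral mN)// integral_mkcond.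
rewrite !ge0_integralTE//; last first.
  by move=> x; rewrite patchE; case: ifPn.
apply: ereal_sup_le => _ [k kf <-]; exists k => // x.
apply: le_trans (kf x) _; rewrite patchE; case: ifPn => //.
rewrite inE => -[_ xN]; apply: contrapT => fg; apply: xN.
exact: fgN.
Qed.

End almost_everywhere.

(* derive1 u takes a default value where u is not derivable; since u is locally
   absolutely continuous, that set is negligible. *)
Theorem theorem3p4 (R : realType) (V : R) :
  exists C : R, forall phi : R -> R, W0 phi ->
    let u : R -> R := fun w => phi w / maxwellian V w in
    AC_loc u /\
    (\int[lebesgue_measure]_w ((u w) ^+ 2 * maxwellian V w)%:E <=
     C%:E * \int[lebesgue_measure]_w ((derive1 u w) ^+ 2 * maxwellian V w)%:E)%E.
Proof.
exists 1 => phi [[acphi _ [g g2 wphi]] phi1 phi0] u.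
have sE := @infinitely_derivable_inv_maxwellian R V.
have acu : AC_loc u.
  by apply: AC_locM => //; exact: infinitely_derivable_AC_loc.
split=> //; rewrite mul1e.
set E : R -> R := fun w => (maxwellian V w)^-1 in sE.
have cE := infinitely_derivable_continuous sE.
have cE' := infinitely_derivable_continuous (infinitely_derivable_derive1 sE).
have lphi := continuous_locally_integrable (AC_loc_continuous acphi).
have lg := Lfun2_locally_integrable g2.
pose h := fun w => g w * E w + phi w * derive1 E w.
have lh : locally_integrable setT h.
  exact: locally_integrableD (locally_integrableMc lg cE)
    (locally_integrableMc lphi cE').
have uh a b : a < b -> u b - u a = \int[lebesgue_measure]_(x in `]a, b]) h x.
  move=> ab; apply: weak_derivative_FTC => //.
    exact: AC_loc_continuous.
  exact: weak_derivativeM.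
have mu_u : measurable_fun setT u.
  exact: continuous_measurable_fun (AC_loc_continuous acu).
have uM : (fun w => u w * maxwellian V w) = phi.
  by apply/funext => w; rewrite /u divfK// gt_eqF// maxwellian_gt0.
apply: le_trans (@gaussian_poincare R V u h mu_u lh uh _ _) _.
- by rewrite uM; apply/Lfun1_integrable.
- by rewrite uM.
have mh : measurable_fun setT h by case: lh.
have M0 w : 0 <= maxwellian V w by exact/ltW/maxwellian_gt0.
apply: ge0_le_integral_ae.
- apply/measurable_EFinP; apply: measurable_funM; first exact: measurable_funX.
  by apply: continuous_measurable_fun; exact: continuous_maxwellian.
- by move=> w; rewrite lee_fin mulr_ge0// sqr_ge0.
- by move=> w; rewrite lee_fin mulr_ge0// sqr_ge0.
- have := ae_derive1_primitive lh uh.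
  apply: filterS; first exact: (ae_filter_ringOfSetsType lebesgue_measure).
  by move=> w ->.
Qed.
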